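(* Let $\mathbb{R}_l$ be the Sorgenfrey line and let $Q(\mathbb{R}_l)$ be the set of all compact saturated subsets of $\mathbb{R}_l$, ordered by reverse inclusion $\supseteq$. Then the poset $Q(\mathbb{R}_l)$ has one-step closure, and $Q(\mathbb{R}_l)$ is not a continuous poset.
   Context: The Sorgenfrey line $\mathbb{R}_l$ is $\mathbb{R}$ with the topology having $\{[x,y)\mid x<y,\ x,y\in\mathbb{R}\}$ as a base. A subset of a topological space is saturated if it is the intersection of all open sets containing it. Let $P$ be a poset. For $A\subseteq P$, $\mathord{\uparrow}A=\{y\in P: x\le y\text{ for some }x\in A\}$, $\mathord{\downarrow}A=\{y\in P: y\le x\text{ for some }x\in A\}$, and $\mathord{\uparrow}x=\mathord{\uparrow}\{x\}$. A directed subset is a nonempty subset $D$ in which every finite subset has an upper bound in $D$. A subset $U$ is Scott open if $U=\mathord{\uparrow}U$ and for every directed $D$ such that $\sup D$ exists and lies in $U$, $D\cap U\neq\emptyset$; $cl$ denotes closure in the resulting Scott topology. $P$ has one-step closure if $cl(A)=A'$ for every $A\subseteq P$, where $A'=\{x\in P\mid \text{there is a directed } D\subseteq\mathord{\downarrow}A\text{ with } x=\sup D\}$. For $x,y\in P$, $x\ll y$ means: for every directed $D\subseteq P$ for which $\sup D$ exists, $y\le\sup D$ implies $D\cap\mathord{\uparrow}x\neq\emptyset$. $P$ is continuous if for every $x\in P$ the set $\{y\in P\mid y\ll x\}$ is directed and has supremum $x$. *)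

(* Defs.v *)
From HB Require Import structures.
From mathcomp Require Import all_boot all_order all_algebra.
From mathcomp Require Import all_classical all_reals all_analysis.

Set Implicit Arguments.
Unset Strict Implicit.
Unset Printing Implicit Defensive.

Import Order.TTheory GRing.Theory Num.Theory.
Import numFieldNormedType.Exports.

Local Open Scope classical_set_scope.
Local Open Scope order_scope.

Section Poset.
Context {d : Order.disp_t} {P : porderType d}.
Implicit Types (x y s : P) (A D U : set P).

Definition up A : set P := [set y | exists2 x, A x & x <= y].

Definition directed D : Prop :=
  D !=set0 /\
  forall F : set P, finite_set F -> F `<=` D -> exists2 u, D u & ubound F u.

Definition scott_open U : Prop :=
  U = up U /\
  forall D s, directed D -> isLub D s -> U s -> D `&` U !=set0.

Definition way_below x y : Prop :=
  forall D s, directed D -> isLub D s -> y <= s -> D `&` up [set x] !=set0.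

(* the operator usually written A': suprema of directed subsets of down A *)
Definition directed_sups A : set P :=
  [set x | exists D, [/\ directed D, D `<=` down A & isLub D x]].

Lemma scott_openT : scott_open setT.
Proof.
split; first by apply/esym/seteqP; split => // x _; exists x.
by move=> D s [[x Dx] _] _ _; exists x.
Qed.

Lemma scott_openI : setI_closed scott_open.
Proof.
move=> U V [Uup Us] [Vup Vs]; split.
  apply/seteqP; split => [x UVx|y [x [Ux Vx] xy]]; first by exists x.
  by split; [rewrite Uup|rewrite Vup]; exists x.
move=> D s Ddir Ds [/(Us _ _ Ddir Ds)[x [Dx Ux]]].
move=> /(Vs _ _ Ddir Ds)[y [Dy Vy]].
have [||z Dz xyz] := Ddir.2 [set x; y]; first exact: finite_set2.
  by move=> _ [->|->].
by exists z; split => //; split; [rewrite Uup; exists x => //|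
  rewrite Vup; exists y => //]; apply: xyz; [left|right].
Qed.

Lemma scott_open_bigU (I : Type) (f : I -> set P) :
  (forall i, scott_open (f i)) -> scott_open (\bigcup_i f i).
Proof.
move=> fo; split.
  apply/seteqP; split => [x fx|y [x [i _ fix_] xy]]; first by exists x.
  by exists i => //; rewrite (fo i).1; exists x.
move=> D s Ddir Ds [i _ fs]; have [x [Dx fx]] := (fo i).2 _ _ Ddir Ds fs.
by exists x; split => //; exists i.
Qed.

End Poset.

Definition scott {d : Order.disp_t} (P : porderType d) : Type := P.

Section ScottTopology.
Context (d : Order.disp_t) (P : porderType d).

HB.instance Definition _ := Choice.on (scott P).
HB.instance Definition _ := @isOpenTopological.Build (scott P)
  (@scott_open d P) scott_openT scott_openI scott_open_bigU.

Lemma scott_openE : @open (scott P) = @scott_open d P.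
Proof. by []. Qed.

End ScottTopology.

Definition one_step_closure (d : Order.disp_t) (P : porderType d) : Prop :=
  forall A : set P, @closure (scott P) A = directed_sups A.

Definition continuous_poset (d : Order.disp_t) (P : porderType d) : Prop :=
  forall x : P, directed [set y | way_below y x] /\
                isLub [set y | way_below y x] x.

Definition saturated (X : topologicalType) (A : set X) : Prop :=
  A = \bigcap_(U in [set U | open U /\ A `<=` U]) U.

(* The empty set is compact and saturated, hence an element (the top) of Q X. *)
Definition Q (X : topologicalType) : Type :=
  set_type [set K : set X | compact K /\ saturated K].

Fact Q_display : Order.disp_t. Proof. exact: Order.Disp tt tt. Qed.

Section QOrder.
Context (X : topologicalType).

HB.instance Definition _ := SubChoice.on (Q X).

Definition leQ (K L : Q X) : bool := `[< \val L `<=` \val K >].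

Lemma leQ_refl : reflexive leQ.
Proof. by move=> K; apply/asboolP. Qed.

Lemma leQ_anti : antisymmetric leQ.
Proof.
move=> K L /andP[/asboolP LK /asboolP KL].
by apply/val_inj/seteqP; split.
Qed.

Lemma leQ_trans : transitive leQ.
Proof.
move=> L K M /asboolP LK /asboolP ML; apply/asboolP.
exact: subset_trans ML LK.
Qed.

HB.instance Definition _ :=
  Order.Le_isPOrder.Build Q_display (Q X) leQ_refl leQ_anti leQ_trans.

Lemma leQE (K L : Q X) : (K <= L) = `[< \val L `<=` \val K >].
Proof. by []. Qed.

End QOrder.

Definition sorgenfrey (R : realType) : Type := R.

Section SorgenfreyTopology.
Context (R : realType).

HB.instance Definition _ := Pointed.copy (sorgenfrey R) R.

Let D : set (R * R) := [set p | p.1 < p.2].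
Let b (p : R * R) : set (sorgenfrey R) := `[p.1, p.2[%classic.

Let b_cover : \bigcup_(p in D) b p = setT.
Proof.
apply/seteqP; split => // z _; exists ((z : R), (z + 1)%R).
  by rewrite /D /= ltrDl.
by rewrite /b /= in_itv /= lexx ltrDl /=.
Qed.

Let b_join p q z : D p -> D q -> b p z -> b q z ->
  exists r, [/\ D r, b r z & b r `<=` b p `&` b q].
Proof.
rewrite /D /b /= !in_itv /= => _ _ /andP[p1z zp2] /andP[q1z zq2].
exists (Order.max p.1 q.1, Order.min p.2 q.2).
have bz : Order.max p.1 q.1 <= (z : R) < Order.min p.2 q.2.
  by rewrite ge_max lt_min p1z q1z zp2 zq2.
split => //=; first by case/andP: bz; exact: le_lt_trans.
move=> t /=; rewrite !in_itv /= ge_max lt_min.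
by move=> /andP[/andP[-> ->] /andP[-> ->]].
Qed.

HB.instance Definition _ := @isBaseTopological.Build (sorgenfrey R)
  (R * R)%type D b b_cover b_join.

Lemma open_sorgenfreyP (U : set (sorgenfrey R)) :
  open U <-> forall z, U z ->
    exists x y : R, [/\ x < y, `[x, y[%classic z & `[x, y[%classic `<=` U].
Proof.
split=> [[D' D'D <-] z [p D'p pz]|UP].
  exists p.1, p.2; split => //; first exact: D'D.
  by move=> t tp; exists p.
exists [set p | D p /\ b p `<=` U]; first by move=> p [].
apply/seteqP; split => [z [p [_ pU] /pU]//|z /UP[x [y [xy zxy xyU]]]].
by exists (x, y).
Qed.

End SorgenfreyTopology.

(* Main.v *)
Require Import Defs.
From mathcomp Require Import finmap.
From mathcomp Require Import all_boot all_order all_algebra.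
From mathcomp Require Import all_classical all_reals all_analysis.
From mathcomp Require Import lra.

(** The Sorgenfrey line is Hausdorff, so every compact set is saturated, the
    supremum of a directed family in Q(X) is its intersection, and Q(X) is
    well-filtered: an open set around the intersection of a directed family
    already contains a member of it.

    One-step closure comes from one feature of the Sorgenfrey line, that every
    compact K has a countable neighbourhood base, namely the unions of the
    intervals [x, x + 1/n[ over x in K.  Write [A'] for [directed_sups A].
    Countable character makes membership of K in [A'] a purely local property
    ([directed_supsP]): every open U around K leaves room for an N in [down A]
    with K <= N <= U as sets.  Indeed, if N_n is chosen in this way inside the
    n-th basic neighbourhood, the sets K + N_n + N_(n+1) + ... are compact,
    decrease to K, and are larger than N_n as sets, hence lie in [down A].  The
    local property passes to lower elements and, by well-filteredness, to
    directed suprema; thus [A'] is Scott closed and equals the closure of A.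

    Continuity fails because the Sorgenfrey line is nowhere locally compact: a
    compact L contains no interval [x, x + 1/n[, since a strictly increasing
    sequence has no Sorgenfrey cluster point.  Picking z_n in [x, x + 1/n[ outside L, the sets
    {x} + {z_n, z_(n+1), ...} are compact, decrease to {x}, and none of them
    is included in L.  So nothing is way below {x}, whereas in a continuous
    poset the set of elements way below {x} is nonempty.  Both halves rest on
    the same family of tails ([tail_chain]). *)

Set Implicit Arguments.
Unset Strict Implicit.
Unset Printing Implicit Defensive.

Import Order.TTheory GRing.Theory Num.Theory.
Import numFieldNormedType.Exports.
Local Open Scope ring_scope.
Local Open Scope order_scope.
Local Open Scope classical_set_scope.

(** * Directed sets and the Scott closure *)

Lemma directed_range (d : Order.disp_t) (P : porderType d) (t : nat -> P) :
  {homo t : m n / (m <= n)%N >-> m <= n} -> directed (range t).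
Proof.
move=> t_homo; split; first by exists (t 0%N), 0%N.
move=> F /finite_seqP[s ->].
elim: s => [_|x s IH xs_t]; first by exists (t 0%N) => //; exists 0%N.
have [|_ [m _ <-] tm] := IH.
  by move=> y sy; apply/xs_t; rewrite /= in_cons sy orbT.
have [k _ tk] : range t x by apply: xs_t; rewrite /= mem_head.
exists (t (maxn k m)); first by exists (maxn k m).
move=> y /=; rewrite in_cons => /orP[/eqP ->|/tm ym].
  by rewrite -tk t_homo ?leq_maxl.
by rewrite (le_trans ym)// t_homo ?leq_maxr.
Qed.

(** A Scott neighbourhood of a directed supremum meets the directed set, hence
    also A when that set lies below A: one inclusion always holds.  The
    hypotheses say that [directed_sups A] is a Scott closed set containing A,
    which gives the other inclusion. *)
Lemma one_step_closureP (d : Order.disp_t) (P : porderType d) :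
  (forall A : set P, [/\ A `<=` directed_sups A,
     down (directed_sups A) `<=` directed_sups A &
     forall D s, directed D -> D `<=` directed_sups A -> isLub D s ->
       directed_sups A s]) ->
  one_step_closure P.
Proof.
move=> H A; have [AA' dA' sA'] := H A.
apply/seteqP; split => [x clx|x [D [dirD DA Dx]] B]; last first.
  rewrite nbhsE /= => -[U [[Uup Us] Ux] UB].
  have [u [Du Uu]] := Us _ _ dirD Dx Ux.
  have [a [Aa ua]] := DA _ Du.
  by exists a; split => //; apply: UB; rewrite Uup; exists u.
apply: contrapT => nx.
have oA' : scott_open (~` directed_sups A).
  split=> [|D s dirD Ds nA's].
    apply/seteqP; split=> [y ny|y [z nz zy] A'y]; first by exists y.
    by apply: nz; apply: dA'; exists y.
  apply: contrapT => DA'; apply: nA's; apply: sA' Ds => // y Dy.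
  by apply: contrapT => ny; apply: DA'; exists y.
have [|a [Aa]] := clx (~` directed_sups A); last by case; exact: AA'.
by apply: open_nbhs_nbhs; split.
Qed.

(** * Tails attached to a compact set *)

Definition tail {T : Type} (K : set T) (N : nat -> set T) (n : nat) : set T :=
  K `|` \bigcup_k N (n + k)%N.

Definition countable_character {X : topologicalType} (K : set X) : Prop :=
  exists U : nat -> set X, (forall n, open (U n) /\ K `<=` U n) /\
    forall V, open V -> K `<=` V -> \forall n \near \oo, U n `<=` V.

(** A finite subcover of K is an open set around K, so it already covers all but
    finitely many of the N k; each of the remaining ones is compact. *)
Lemma compact_tail (X : ptopologicalType) (K : set X) (N : nat -> set X) n :
  compact K -> (forall k, compact (N k)) ->
  (forall V, open V -> K `<=` V -> \forall k \near \oo, N k `<=` V) ->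
  compact (tail K N n).
Proof.
move=> cK cN NV; rewrite compact_cover => I D f fo Mf.
have := cK; rewrite compact_cover.
move=> /(_ I D f fo (subset_trans (@subsetUl _ _ _) Mf))[D1 D1D KD1].
have [|m _ mV] := NV _ _ KD1.
  by apply: bigcup_open => i /D1D; rewrite inE => /fo.
have : compact (\big[setU/set0]_(k < m) N (n + k)%N).
  by apply: bigsetU_compact => k _; exact: cN.
rewrite compact_cover => /(_ I D f fo)[|D2 D2D ND2].
  by apply: subset_trans Mf; apply: subset_trans (@subsetUr _ _ _);
     exact: (@bigsetU_bigcup _ (fun k => N (n + k)%N)).
exists (D1 `|` D2)%fset.
  by move=> i; rewrite in_fsetU => /orP[/D1D|/D2D].
have D1U : cover [set` D1] f `<=` cover [set` (D1 `|` D2)%fset] f.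
  by move=> x [i iD fx]; exists i => //=; rewrite in_fsetU [i \in D1]iD.
move=> x [/KD1/D1U//|[k _ Nx]].
have [mk|km] := leqP m k.
  by apply/D1U/(mV (n + k)%N) => //=; rewrite (leq_trans mk)// leq_addl.
have [|i iD fx] := ND2 x; last first.
  by exists i => //=; rewrite in_fsetU [i \in D2]iD orbT.
by rewrite -(bigcup_mkord m (fun k => N (n + k)%N)); exists k.
Qed.

(** * Compact saturated sets of a Hausdorff space *)

Section HausdorffQ.
Context (X : ptopologicalType) (hX : hausdorff_space X).
Implicit Types (K L : Q X) (D A : set (Q X)).

Lemma closed_point (x : X) : closed [set x].
Proof. exact/accessible_closed_set1/hausdorff_accessible. Qed.

Lemma leQP K L : reflect (\val L `<=` \val K) (K <= L).
Proof. by rewrite leQE; exact: asboolP. Qed.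

Lemma Q_compact K : compact (\val K).
Proof. by have [] := set_valP K. Qed.

(** Points are closed, so any set is the intersection of the complements of the
    points outside it: saturation is automatic. *)
Lemma compact_Q (C : set X) : compact C -> {K : Q X | \val K = C}.
Proof.
move=> cC.
suff CQ : C \in [set K : set X | compact K /\ saturated K].
  by exists (exist _ C CQ).
rewrite inE; split => //; apply/seteqP; split => [x Cx U [_]|x Cx]; first exact.
apply: contrapT => nCx; apply: (Cx (~` [set x])) => //.
split; first exact/closed_openC/closed_point.
by move=> y Cy /= yx; apply: nCx; rewrite -yx.
Qed.

Lemma isLub_Q D K : D !=set0 -> isLub D K -> \val K = \bigcap_(M in D) \val M.
Proof.
move=> [M0 DM0] [ubK lubK].
have [|L LE] := @compact_Q (\bigcap_(M in D) \val M).
  apply: (@subclosed_compact _ _ (\val M0)); last by move=> x /(_ _ DM0).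
  by apply: closed_bigI => M _; exact: compact_closed (@Q_compact M).
  exact: Q_compact.
apply/seteqP; split; first by move=> x Kx M /ubK/leQP; exact.
by rewrite -LE; apply/leQP/lubK => M DM; apply/leQP; rewrite LE => x; exact.
Qed.

Lemma bigcap_isLub D K : \val K = \bigcap_(M in D) \val M -> isLub D K.
Proof.
move=> KE; split=> [M DM|L ubL]; apply/leQP; rewrite KE; first by move=> x; exact.
by move=> x Lx M /ubL/leQP; exact.
Qed.

(** Otherwise the sets M \ U, for M in D, generate a proper filter on a compact
    set.  These sets are closed, so a cluster point belongs to all of them: it
    is a point of the intersection of D outside U. *)
Lemma well_filtered D (U : set X) : directed D -> open U ->
  \bigcap_(M in D) \val M `<=` U -> exists2 M, D M & \val M `<=` U.
Proof.
move=> [[M0 DM0] dirD] oU DU; apply: contrapT => nU.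
have DF : ProperFilter (filter_from D (fun M => \val M `\` U)).
  apply: filter_from_proper.
    apply: filter_from_filter; first by exists M0.
    move=> M L DM DL; have [||W DW WML] := dirD [set M; L].
    - exact: finite_set2.
    - by move=> _ [->|->].
    exists W => // x [Wx Ux].
    have /leQP/(_ _ Wx) Mx := WML M (or_introl erefl).
    by have /leQP/(_ _ Wx) Lx := WML L (or_intror erefl).
  move=> M DM; apply: contrapT => nM; apply: nU; exists M => // x Mx.
  by apply: contrapT => Ux; apply: nM; exists x.
have [|x [_ clx]] := @Q_compact M0 _ DF; first by exists M0 => // x [].
have clM M : D M -> (\val M `\` U) x.
  move=> DM; have clMU : closed (\val M `\` U).
    by apply: closedI; [exact: compact_closed (@Q_compact M)|exact: open_closedC].
  by apply: clMU => B xB; apply: clx => //; exists M.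
by have [_] := clM _ DM0; apply; apply: DU => M /clM[].
Qed.

(** Compact sets shrinking towards K produce a directed family with supremum K.
    The chain [t] is increasing for reverse inclusion, and no point y outside K
    survives in its intersection, as the complement of y is an open set around
    K. *)
Lemma tail_chain K (N : nat -> set X) : (forall k, compact (N k)) ->
  (forall V, open V -> \val K `<=` V -> \forall k \near \oo, N k `<=` V) ->
  exists t : nat -> Q X, [/\ forall n, \val (t n) = tail (\val K) N n,
    directed (range t) & isLub (range t) K].
Proof.
move=> cN NV.
pose t n := sval (compact_Q (@compact_tail _ _ _ n (@Q_compact K) cN NV)).
have tE n : \val (t n) = tail (\val K) N n by rewrite /t; case: compact_Q.
exists t; split => //.
  apply: directed_range => m n mn; apply/leQP; rewrite !tE.
  apply: setUS => x [k _ Nx]; exists (n - m + k)%N => //.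
  by rewrite addnA subnKC.
apply: bigcap_isLub; apply/seteqP; split.
  by move=> x Kx _ [n _ <-]; rewrite tE; left.
move=> x tx; apply: contrapT => nKx.
have [||m _ mN] := NV (~` [set x]).
- exact/closed_openC/closed_point.
- by move=> y Ky yx; apply: nKx; rewrite -yx.
have := tx (t m) (imageT _ _); rewrite tE => -[//|[k _ Nx]].
by apply: (mN (m + k)%N _ x) => //=; exact: leq_addr.
Qed.

(** One direction is well-filteredness.  For the other, members of [down A]
    chosen between K and each set of a countable base have tails that form the
    required directed family.  The right-hand side treats one open set at a
    time and asks for no directedness, so it passes to lower elements and to
    directed suprema. *)
Lemma directed_supsP A K : countable_character (\val K) ->
  directed_sups A K <->
  forall U, open U -> \val K `<=` U ->
    exists N, [/\ down A N, \val K `<=` \val N & \val N `<=` U].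
Proof.
move=> [V [oV VK]]; split.
  move=> [D [dirD DA DK]] U oU KU.
  have [|M DM MU] := well_filtered dirD oU; first by rewrite -(isLub_Q dirD.1 DK).
  by exists M; split => //; [exact: DA|exact/leQP/DK.1].
move=> approx.
have /choice[N NP] n := approx (V n) (oV n).1 (oV n).2.
have [|U oU KU|t [tE dirt tK]] := @tail_chain K (fun n => \val (N n)).
- by move=> n; exact: Q_compact.
- by near=> n; have [_ _ /subset_trans] := NP n; apply; near: n; exact: VK.
exists (range t); split => // _ [n _ <-].
have [[a [Aa Na]] _ _] := NP n.
exists a; split => //; apply: le_trans Na; apply/leQP; rewrite tE.
by move=> x Nx; right; exists 0%N => //; rewrite addn0.
Unshelve. all: by end_near. Qed.

Lemma Q_one_step_closure :
  (forall K, countable_character (\val K)) -> one_step_closure (Q X).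
Proof.
move=> ccX; apply: one_step_closureP => A; split.
- move=> K AK; apply/directed_supsP => // U oU KU; exists K; split => //.
  by exists K.
- move=> L [K [/directed_supsP-/(_ (ccX K)) approx LK]].
  apply/directed_supsP => // U oU LU.
  have [|N [[a [Aa Na]] KN NU]] := approx U oU.
    by apply: subset_trans LU; exact/leQP.
  (* Adding L to an approximation of K gives one of L. *)
  have [M ME] := compact_Q (compactU (@Q_compact N) (@Q_compact L)).
  exists M; split; rewrite ?ME; [|exact: subsetUr|by rewrite subUset].
  by exists a; split => //; apply: le_trans Na; apply/leQP; rewrite ME; left.
- move=> D K dirD DA DK; apply/directed_supsP => // U oU KU.
  have [|M DM MU] := well_filtered dirD oU; first by rewrite -(isLub_Q dirD.1 DK).
  have /directed_supsP-/(_ (ccX M)) approx := DA _ DM.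
  have [N [AN MN NU]] := approx _ oU MU.
  by exists N; split => //; apply: subset_trans MN; exact/leQP/DK.1.
Qed.

End HausdorffQ.

(** * The Sorgenfrey line *)

Section Sorgenfrey.
Context (R : realType).
Local Notation S := (sorgenfrey R).
Implicit Types (K L V : set S) (x y : R).

Lemma open_itvco x y : open (`[x, y[ : set S).
Proof.
apply/open_sorgenfreyP => z zxy; exists x, y; split => //.
by move: zxy; rewrite /= in_itv /= => /andP[]; exact: le_lt_trans.
Qed.

Lemma nbhs_itvco x y : x < y -> nbhs (x : S) (`[x, y[ : set S).
Proof.
move=> xy; apply: open_nbhs_nbhs; split; first exact: open_itvco.
by rewrite /= in_itv /= lexx.
Qed.

Lemma open_itvcoP V x : open V -> V x ->
  exists2 e : R, 0 < e & `[x, x + e[ `<=` V.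
Proof.
move=> /open_sorgenfreyP oV /oV[a [b [_]]]; rewrite /= in_itv /= => /andP[ax xb] abV.
exists (b - x); first by rewrite subr_gt0.
apply: subset_trans abV => z /=; rewrite !in_itv /= addrC subrK.
by move=> /andP[/(le_trans ax) -> ->].
Qed.

Lemma sorgenfrey_hausdorff : hausdorff_space S.
Proof.
rewrite open_hausdorff => x y.
wlog xy : x y / (x : R) < y => [H xy|_].
  have [lt_xy|lt_yx|eq_xy] := ltgtP (x : R) y; first exact: H.
  - have [|[A B] /= [yA xB] [oA oB AB]] := H y x lt_yx; first by rewrite eq_sym.
    by exists (B, A) => //=; split => //; rewrite setIC.
  - by move: xy; rewrite -[x]/(x : R) eq_xy eqxx.
exists (`[x : R, y : R[, `[y : R, (y : R) + 1[) => /=.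
  by rewrite !inE /= !in_itv /= !lexx xy ltrDl ltr01.
split; try exact: open_itvco.
apply/eqP/seteqP; split => // z [] /=; rewrite !in_itv /= => /andP[_ zy] /andP[yz _].
by move: (lt_le_trans zy yz); rewrite ltxx.
Qed.

Definition right_fan K (n : nat) : set S :=
  \bigcup_(x in K) `[x : R, (x : R) + n.+1%:R^-1[.

(** A one-sided Lebesgue number: if [x, x + e[ is included in V, the single
    radius e/2 serves all the points of the neighbourhood [x, x + e/2[ of x, and
    compactness of K makes the radius uniform. *)
Lemma right_fan_sub K V : compact K -> open V -> K `<=` V ->
  \forall n \near \oo, right_fan K n `<=` V.
Proof.
move=> /compact_near_coveringP cK oV KV.
have fanV := cK nat \oo
  (fun n (x : S) => `[x : R, (x : R) + n.+1%:R^-1[ `<=` V) _ _.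
apply: filterS (fanV _ _) => [n KnV z [x Kx]|x Kx]; first exact: KnV.
have [e e0 eV] := open_itvcoP oV (KV x Kx).
have e20 : 0 < e / 2 by rewrite divr_gt0.
exists (`[x : R, (x : R) + e / 2[, [set n | n.+1%:R^-1 < e / 2]).
  split; first by apply: nbhs_itvco; rewrite ltrDl.
  exact: (near_infty_natSinv_lt (PosNum e20)).
move=> [y n] /= []; rewrite in_itv /= => /andP[xy ye] ne z.
rewrite /= in_itv /= => /andP[yz zn]; apply: eV; rewrite /= in_itv /= (le_trans xy yz) /=.
by apply: (lt_trans zn); rewrite (splitr e) addrA ltrD.
Qed.

Lemma sorgenfrey_countable_character K : compact K -> countable_character K.
Proof.
move=> cK; exists (right_fan K); split => [n|V]; last exact: right_fan_sub.
split; first by apply: bigcup_open => x _; exact: open_itvco.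
by move=> x Kx; exists x => //=; rewrite in_itv /= lexx ltrDl invr_gt0 ltr0n.
Qed.

(** If [x, y[ were included in L, the Euclidean filter of left neighbourhoods
    of y would live on L.  It has no cluster point z in the Sorgenfrey topology:
    if z < y then the values near y eventually leave [z, (z + y)/2[, and if
    y <= z they never enter [z, z + 1[. *)
Lemma compact_misses_itvco L x y : compact L -> x < y ->
  exists2 z, `[x, y[ z & ~ L z.
Proof.
move=> cL xy; apply: contrapT => xyL.
have FL : (y : R)^'- L.
  near=> z; apply: contrapT => Lz; apply: xyL; exists z => //=.
  rewrite in_itv /=; apply/andP; split; last by near: z; exact: nbhs_left_lt.
  by apply: ltW; near: z; exact: nbhs_left_gt.
have [z [_ clz]] := cL _ (at_left_proper_filter (y : R)) FL.
have [zy|yz] := ltP (z : R) y.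
- pose w := ((z : R) + y) / 2.
  have [||t []] := clz [set t | w < t] (`[z : R, w[).
  + by apply: nbhs_left_gt; rewrite /w; lra.
  + by apply: nbhs_itvco; rewrite /w; lra.
  + by rewrite /= in_itv /= => wt /andP[_ /(lt_trans wt)]; rewrite ltxx.
- have [||t []] := clz [set t | t < y] (`[z : R, (z : R) + 1[).
  + exact: nbhs_left_lt.
  + by apply: nbhs_itvco; rewrite ltrDl.
  + rewrite /= in_itv /= => ty /andP[/(le_trans yz) /(lt_le_trans ty)].
    by rewrite ltxx.
Unshelve. all: by end_near. Qed.

(** Points z n outside L that converge to x from the right give a chain with
    supremum {x}, none of whose members is included in L. *)
Lemma not_way_below_point (x : S) (K L : Q S) :
  \val K = [set x] -> ~ way_below L K.
Proof.
move=> KE LK.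
have /choice[z zP] (n : nat) :
    exists z, `[x : R, (x : R) + n.+1%:R^-1[ z /\ ~ \val L z.
  have [||z xz Lz] := @compact_misses_itvco (\val L) x ((x : R) + n.+1%:R^-1).
  - exact: Q_compact.
  - by rewrite ltrDl invr_gt0 ltr0n.
  - by exists z.
have [||t [tE dirt tK]] :=
  @tail_chain _ sorgenfrey_hausdorff K (fun n => [set (z n : S)]).
- by move=> k; exact: compact_set1.
- move=> V oV KV; have := right_fan_sub (@Q_compact _ K) oV KV.
  apply: filterS => n; apply: subset_trans => _ ->.
  by exists x; [rewrite KE|exact: (zP n).1].
have [_ [[n _ <-] [_ -> /leQP tL]]] := LK _ _ dirt tK (lexx K).
by apply: (zP n).2; apply: tL; rewrite tE; right; exists 0%N => //=; rewrite addn0.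
Qed.

End Sorgenfrey.

Theorem theorem4p2 (R : realType) :
  one_step_closure (Q (sorgenfrey R)) /\ ~ continuous_poset (Q (sorgenfrey R)).
Proof.
split.
  apply: Q_one_step_closure => [|K]; first exact: sorgenfrey_hausdorff.
  exact/sorgenfrey_countable_character/Q_compact.
move=> cont.
have [K KE] := compact_Q (@sorgenfrey_hausdorff R)
  (@compact_set1 (sorgenfrey R) (0 : R)).
have [[[L LK] _] _] := cont K.
exact: not_way_below_point KE LK.
Qed.
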